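(* Let $c\ge 2$ and $d\ge 2$ be integers. If $A\subset\mathbb{Z}_c$ is a regular polygon with $d$ elements, i.e. a translate of some subgroup $f\mathbb{Z}_c$ of $\mathbb{Z}_c$ having $d$ elements, then $A$ has exactly $\Phi(d)$ generators.
   Context: $\mathbb{Z}_c=\mathbb{Z}/c\mathbb{Z}$ is the cyclic group with $c$ elements, and $f\mathbb{Z}_c$ is the subgroup generated by $f$. $\Phi$ is Euler's totient function. A subset $A\subset\mathbb{Z}_c$ with $d$ elements is generated by $g\in\mathbb{Z}_c$ (and $g$ is a generator of $A$) if $A=\{a,a+g,a+2g,\dots,a+(d-1)g\}$ for some $a\in A$. The number of generators of $A$ is the number of distinct such $g\in\mathbb{Z}_c$. *)

(* Defs.v *)
From HB Require Import structures.
From mathcomp Require Import all_boot all_order all_algebra all_fingroup.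

Set Implicit Arguments.
Unset Strict Implicit.
Unset Printing Implicit Defensive.

Import GRing.Theory.
Local Open Scope ring_scope.

(* The cyclic group Z/cZ is 'Z_c, which denotes it only for 1 < c; the
   definitions below are meant to be used under that hypothesis. The
   finGroupType structure of 'Z_c is additive, so <[f]>%g is the additive
   subgroup generated by f. *)

Definition generated_by (c : nat) (A : {set 'Z_c}) (g : 'Z_c) : bool :=
  [exists a in A, A == [set a + g *+ (i : nat) | i : 'I_#|A|]].

Definition generators (c : nat) (A : {set 'Z_c}) : {set 'Z_c} :=
  [set g | generated_by A g].

Definition translate (c : nat) (x : 'Z_c) (H : {set 'Z_c}) : {set 'Z_c} :=
  [set x + h | h in H].

Definition regular_polygon (c d : nat) (A : {set 'Z_c}) : Prop :=
  exists f x : 'Z_c, #|<[f]>%g| = d /\ A = translate x <[f]>%g.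

(* Main.v *)
Require Import Defs.
From mathcomp Require Import all_boot all_order all_algebra all_fingroup.
From mathcomp Require Import cyclic.

Set Implicit Arguments.
Unset Strict Implicit.
Unset Printing Implicit Defensive.

(** A progression of difference [g] that fills a coset of a subgroup [H] with
    at least two elements contains two consecutive terms, whose difference [g]
    must then lie in [H]. Translating the first term to [0], the progression
    becomes a set of multiples of [g] equal to [H], so [g] generates [H];
    conversely the first [#|H|] multiples of a group generator of [H] exhaust
    [H]. The generators of the polygon are thus the group generators of the
    cyclic group [<[f]>], of which there are [totient d]; this is
    [generated_by_lcoset] followed by the count [totient_gen].

    The group law on ['Z_c] is its addition, so below a product is a sum and
    a power is a multiple. *)

Local Open Scope group_scope.

Section Polygon.

Variable c : nat.
Implicit Types (a g x : 'Z_c) (A : {set 'Z_c}) (H : {group 'Z_c}).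

Lemma translateE x A : translate x A = x *: A.
Proof. by rewrite -lcosetE. Qed.

Lemma mem_progression n a g i :
  i < n -> a * g ^+ i \in [set (a + g *+ (j : nat))%R | j : 'I_n].
Proof. by move=> lt_in; apply/imsetP; exists (Ordinal lt_in). Qed.

(** The bound on [#|H|] makes the second term of the progression exist: a
    single point is a progression of every difference. *)
Lemma generated_by_lcoset H x g :
  1 < #|H| -> generated_by (x *: H) g = generator H g.
Proof.
move=> H_gt1; rewrite /generated_by card_lcoset.
apply/exists_inP/eqP => [[a a_xH /eqP defA] | defH].
  have {}defA : a *: H = [set (a + g *+ (i : nat))%R | i : 'I_#|H|].
    by rewrite -defA; apply/lcoset_eqP.
  have Hg : g \in H.
    by have := mem_progression a g H_gt1; rewrite -defA mem_lcoset expg1 mulKg.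
  apply/eqP; rewrite eqEsubset cycle_subG Hg andbT; apply/subsetP=> h Hh.
  have : a * h \in a *: H by rewrite mem_lcoset mulKg.
  rewrite defA => /imsetP[i _].
  rewrite -FinRing.zmodXgE -FinRing.zmodMgE => /mulgI ->.
  exact: mem_cycle.
exists x; first exact: lcoset_refl.
rewrite eqEsubset; apply/andP; split; apply/subsetP=> y.
  rewrite mem_lcoset {1}defH => /cyclePmin[i lt_i def_y].
  by rewrite -(mulKVg x y) def_y mem_progression // defH.
case/imsetP=> i _ ->.
rewrite -FinRing.zmodXgE -FinRing.zmodMgE.
by rewrite mem_lcoset mulKg groupX // defH cycle_id.
Qed.

End Polygon.

Local Close Scope group_scope.

Theorem theorem2 (c d : nat) (hc : 2 <= c) (hd : 2 <= d) (A : {set 'Z_c})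
  (hA : regular_polygon d A) : #|generators A| = totient d.
Proof.
case: hA => f [x [card_f ->]].
rewrite -card_f totient_gen; apply: eq_card => g.
by rewrite !inE translateE generated_by_lcoset ?card_f.
Qed.
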